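(* Let $\rho=\frac12(\mathbb{1}_2+\vec n\cdot\vec\sigma)$ with $\vec n\in\mathbb{R}^3$, $|\vec n|\le1$, be a qubit state. For all $0\le\theta\le\pi$ and $0\le\phi\le2\pi$, with the mutually unbiased bases $B_1,B_2,B_3$ of $\mathbb{C}^2$ determined by $(\theta,\phi)$, the following imaginarity complementarity relations hold: $$\mathscr{I}_R^{B_2}(\rho)+\mathscr{I}_R^{B_3}(\rho)\le\sqrt2\quad\text{and}\quad\mathscr{I}_R^{B_1}(\rho)+\mathscr{I}_R^{B_3}(\rho)\le\sqrt2 .$$ Similarly, for the $x$- and $y$-bases, $\mathscr{I}_R^x(\rho)+\mathscr{I}_R^y(\rho)\le\sqrt2$, with equality for $\rho=\frac12\big(\mathbb{1}_2+\frac1{\sqrt2}(\sigma_x+\sigma_y)\big)$.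
   Context: $\vec\sigma=(\sigma_x,\sigma_y,\sigma_z)$ is the vector of Pauli matrices. For a density matrix $\rho$ on $\mathbb{C}^2$ and an ordered orthonormal basis $B=\{|e_0\rangle,|e_1\rangle\}$, let $\rho_B=(\langle e_i|\rho|e_j\rangle)_{i,j}$. The robustness of imaginarity of $\rho$ in the basis $B$ is $\mathscr{I}_R^B(\rho)=\frac12\|\rho_B-\rho_B^T\|_1$, where $T$ is the transpose and $\|V\|_1=\operatorname{Tr}\sqrt{V^\dagger V}$. Put $|u\rangle=\cos\frac\theta2|0\rangle+e^{i\phi}\sin\frac\theta2|1\rangle$ and $|d\rangle=\sin\frac\theta2|0\rangle-e^{i\phi}\cos\frac\theta2|1\rangle$. Then $B_1=\{|u\rangle,|d\rangle\}$, $B_2=\{(|u\rangle+|d\rangle)/\sqrt2,(|u\rangle-|d\rangle)/\sqrt2\}$, $B_3=\{(|u\rangle+i|d\rangle)/\sqrt2,(|u\rangle-i|d\rangle)/\sqrt2\}$. The $x$-basis is $\{(|0\rangle+|1\rangle)/\sqrt2,(|0\rangle-|1\rangle)/\sqrt2\}$ and the $y$-basis is $\{(|0\rangle+i|1\rangle)/\sqrt2,(|0\rangle-i|1\rangle)/\sqrt2\}$; $\mathscr{I}_R^x,\mathscr{I}_R^y$ denote the robustness of imaginarity in these bases. *)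

(* Defs.v *)
From HB Require Import structures.
From mathcomp Require Import all_boot all_order all_algebra.
From mathcomp Require Import spectral sesquilinear.
From mathcomp Require Import complex ring lra.
From mathcomp Require Import all_classical all_reals all_analysis.

Set Implicit Arguments.
Unset Strict Implicit.
Unset Printing Implicit Defensive.

Import Order.TTheory GRing.Theory Num.Theory.
Local Open Scope ring_scope.
Local Open Scope complex_scope.
Local Open Scope sesquilinear_scope.

(* Positive square root by functional calculus: spectralmx A is unitary and
   A = (spectralmx A)^-1 *m diag_mx (spectral_diag A) *m spectralmx A for
   normal A.  It is only meaningful for positive semidefinite A, see
   sqrtmx_psd below. *)
Definition sqrtmx (C : numClosedFieldType) (n : nat) (A : 'M[C]_n) : 'M[C]_n :=
  invmx (spectralmx A) *m diag_mx (map_mx sqrtC (spectral_diag A))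
    *m spectralmx A.

Definition trace_norm (C : numClosedFieldType) (n : nat) (V : 'M[C]_n) : C :=
  \tr (sqrtmx (V ^t* *m V)).

Definition psdmx (C : numClosedFieldType) (n : nat) (A : 'M[C]_n) : Prop :=
  A ^t* = A /\ forall x : 'cV[C]_n, 0 <= (x ^t* *m A *m x) 0 0.

Definition density_matrix (C : numClosedFieldType) (n : nat) (A : 'M[C]_n) :
  Prop := psdmx A /\ \tr A = 1.

Definition braket (C : numClosedFieldType) (n : nat) (x y : 'cV[C]_n) : C :=
  (x ^t* *m y) 0 0.

Definition mx_in_basis (C : numClosedFieldType) (n : nat)
    (B : n.-tuple 'cV[C]_n) (rho : 'M[C]_n) : 'M[C]_n :=
  \matrix_(i, j) braket (tnth B i) (rho *m tnth B j).

(* The value is a nonnegative real number, kept in C; recall that x <= y in C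
   means that y - x is a nonnegative real. *)
Definition robustness_imag (C : numClosedFieldType) (n : nat)
    (B : n.-tuple 'cV[C]_n) (rho : 'M[C]_n) : C :=
  2^-1 * trace_norm (mx_in_basis B rho - (mx_in_basis B rho)^T).

Definition orthonormal_basis (C : numClosedFieldType) (n : nat)
    (B : n.-tuple 'cV[C]_n) : Prop :=
  forall i j, braket (tnth B i) (tnth B j) = (i == j)%:R.

Definition mutually_unbiased (C : numClosedFieldType) (n : nat)
    (A B : n.-tuple 'cV[C]_n) : Prop :=
  forall i j, `|braket (tnth A i) (tnth B j)| ^+ 2 = n%:R^-1.

Section Qubit.
Variable R : realType.

(* A bare 'i would be parsed as Num.imaginary; 'i%C is 0 +i* 1. *)
Definition sigma_x : 'M[R[i]]_2 := delta_mx 0 1 + delta_mx 1 0.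
Definition sigma_y : 'M[R[i]]_2 := - 'i%C *: delta_mx 0 1 + 'i%C *: delta_mx 1 0.
Definition sigma_z : 'M[R[i]]_2 := delta_mx 0 0 - delta_mx 1 1.

Definition pauli : 3.-tuple 'M[R[i]]_2 := [tuple sigma_x; sigma_y; sigma_z].

Definition qubit_state (n : 'rV[R]_3) : 'M[R[i]]_2 :=
  2^-1 *: (1%:M + \sum_i (n 0 i)%:C *: tnth pauli i).

(* The canonical norm on 'rV[R]_3 is the sup norm, hence this definition. *)
Definition euclidean_norm (n : 'rV[R]_3) : R := Num.sqrt (\sum_i n 0 i ^+ 2).

Definition ket (k : 'I_2) : 'cV[R[i]]_2 := delta_mx k 0.

Definition expi (t : R) : R[i] := cos t +i* sin t.

Definition ket_u (theta phi : R) : 'cV[R[i]]_2 :=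
  (cos (theta / 2))%:C *: ket 0 + (expi phi * (sin (theta / 2))%:C) *: ket 1.

Definition ket_d (theta phi : R) : 'cV[R[i]]_2 :=
  (sin (theta / 2))%:C *: ket 0 - (expi phi * (cos (theta / 2))%:C) *: ket 1.

Definition sum_basis (a b : 'cV[R[i]]_2) : 2.-tuple 'cV[R[i]]_2 :=
  [tuple (Num.sqrt 2)^-1%:C *: (a + b); (Num.sqrt 2)^-1%:C *: (a - b)].

Definition B1 (theta phi : R) : 2.-tuple 'cV[R[i]]_2 :=
  [tuple ket_u theta phi; ket_d theta phi].
Definition B2 (theta phi : R) : 2.-tuple 'cV[R[i]]_2 :=
  sum_basis (ket_u theta phi) (ket_d theta phi).
Definition B3 (theta phi : R) : 2.-tuple 'cV[R[i]]_2 :=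
  sum_basis (ket_u theta phi) ('i%C *: ket_d theta phi).

Definition x_basis : 2.-tuple 'cV[R[i]]_2 := sum_basis (ket 0) (ket 1).
Definition y_basis : 2.-tuple 'cV[R[i]]_2 := sum_basis (ket 0) ('i%C *: ket 1).

End Qubit.

Arguments sigma_x {R}.
Arguments sigma_y {R}.
Arguments sigma_z {R}.
Arguments ket {R}.
Arguments x_basis {R}.
Arguments y_basis {R}.

Lemma psdmx_normal (C : numClosedFieldType) (n : nat) (A : 'M[C]_n) :
  psdmx A -> A \is normalmx.
Proof. by case=> Ah _; apply/normalmxP; rewrite Ah. Qed.

Lemma gram_psdmx (C : numClosedFieldType) (n : nat) (V : 'M[C]_n) :
  psdmx (V ^t* *m V).
Proof.
split=> [|x]; first by rewrite trmx_mul map_mxM trmxCK.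
rewrite mulmxA -mulmxA.
have -> : x ^t* *m V ^t* = (V *m x) ^t* by rewrite trmx_mul map_mxM.
rewrite mxE sumr_ge0// => k _.
by rewrite 2!mxE mulrC mul_conjC_ge0.
Qed.

Lemma sqrtmx_psd (C : numClosedFieldType) (n : nat) (A : 'M[C]_n) :
  psdmx A -> psdmx (sqrtmx A) /\ sqrtmx A *m sqrtmx A = A.
Proof.
move=> Apsd; have [_ Age0] := Apsd.
have /orthomx_spectralP Aeq := psdmx_normal Apsd.
have Pu := spectral_unitarymx A; have Punit := spectral_unit A.
have PP := unitarymxP Pu.
set P := spectralmx A in Aeq Pu Punit PP; set s := spectral_diag A in Aeq.
have s_ge0 i : 0 <= s 0 i.
  have := Age0 (col i (P ^t*)).
  have -> : (col i (P ^t*)) ^t* = row i P.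
    by apply/matrixP => a b; rewrite !mxE conjCK.
  rewrite colE rowE {1}Aeq invmx_unitary// !mulmxA.
  rewrite -(mulmxA _ P (P ^t*)) PP mulmx1.
  rewrite -(mulmxA _ P (P ^t*)) PP mulmx1.
  rewrite -rowE row_diag_mx -scalemxAl mul_delta_mx.
  by rewrite !mxE !eqxx mulr1.
rewrite /sqrtmx -/P -/s; set D := diag_mx _.
have DD : D *m D = diag_mx s.
  rewrite mulmx_diag; congr diag_mx; apply/rowP => i.
  by rewrite !mxE -expr2 sqrtCK.
have Dh : D ^t* = D.
  rewrite tr_diag_mx map_diag_mx; congr diag_mx; apply/rowP => i.
  by rewrite !mxE; apply/CrealP/ger0_real; rewrite sqrtC_ge0.
split; last by rewrite !mulmxA mulmxK// -(mulmxA _ D D) DD -Aeq.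
rewrite invmx_unitary//; split=> [|x].
  by rewrite !trmx_mul !map_mxM trmxCK Dh mulmxA.
rewrite !mulmxA.
have -> : x ^t* *m P ^t* = (P *m x) ^t* by rewrite trmx_mul map_mxM.
rewrite -(mulmxA _ P) mul_mx_diag mxE sumr_ge0// => k _.
rewrite 3!mxE mulrAC mulr_ge0// ?mxE ?sqrtC_ge0//.
by rewrite mulrC mul_conjC_ge0.
Qed.

Section Braket.
Variables (C : numClosedFieldType) (n : nat).
Implicit Types (x y z : 'cV[C]_n) (c : C).

Lemma braketDr x y z : braket x (y + z) = braket x y + braket x z.
Proof. by rewrite /braket mulmxDr mxE. Qed.

Lemma braketZr c x y : braket x (c *: y) = c * braket x y.
Proof. by rewrite /braket -scalemxAr mxE. Qed.

Lemma braketC x y : braket x y = (braket y x)^*%R.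
Proof.
rewrite /braket !mxE rmorph_sum; apply: eq_bigr => k _.
by rewrite !mxE rmorphM /= conjCK mulrC.
Qed.

Lemma braketDl x y z : braket (x + y) z = braket x z + braket y z.
Proof. by rewrite braketC braketDr rmorphD /= -!braketC. Qed.

Lemma braketZl c x y : braket (c *: x) y = c^*%R * braket x y.
Proof. by rewrite braketC braketZr rmorphM /= -braketC. Qed.

Lemma braketNr x y : braket x (- y) = - braket x y.
Proof. by rewrite -scaleN1r braketZr mulN1r. Qed.

Lemma braketNl x y : braket (- x) y = - braket x y.
Proof. by rewrite braketC braketNr rmorphN /= -braketC. Qed.

End Braket.

Section QubitFacts.
Variable R : realType.
Implicit Types (theta phi : R) (a b : 'cV[R[i]]_2).

Lemma ord2P (P : 'I_2 -> Prop) : P 0 -> P 1 -> forall i, P i.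
Proof.
move=> P0 P1 [[|[|//]] i2].
- by rewrite (_ : Ordinal i2 = 0)//; exact/val_inj.
- by rewrite (_ : Ordinal i2 = 1)//; exact/val_inj.
Qed.

Lemma braket_ket (k l : 'I_2) : braket (ket k) (ket l) = (k == l)%:R :> R[i].
Proof.
rewrite /braket /ket trmx_delta map_delta_mx mul_delta_mx_cond.
by case: eqP => _; rewrite ?mulr1n ?mulr0n mxE ?eqxx.
Qed.

Definition orthonormal_pair a b :=
  [/\ braket a a = 1, braket b b = 1, braket a b = 0 & braket b a = 0].

Lemma pair_basis_orthonormal a b : orthonormal_pair a b ->
  orthonormal_basis [tuple a; b].
Proof.
by case=> aa bb ab ba; apply: ord2P; apply: ord2P; rewrite !(tnth_nth 0).
Qed.

Lemma conj_real (x : R) : (x%:C)^*%R = x%:C.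
Proof. by apply/CrealP; rewrite complex_real. Qed.

Lemma invsqrt2_sqr : (Num.sqrt 2)^-1%:C * (Num.sqrt 2)^-1%:C = 2^-1 :> R[i].
Proof.
by rewrite -rmorphM -expr2 exprVn sqr_sqrtr// fmorphV rmorph_nat.
Qed.

Lemma expi_conj (t : R) : (expi t)^*%R * expi t = 1.
Proof.
apply/eqP; rewrite eq_complex /= !mulNr opprK -!expr2 cos2Dsin2 eqxx /=.
by rewrite mulrC subrr.
Qed.

Definition bkE := (braketDl, braketDr, braketZl, braketZr, braketNl, braketNr).

Lemma ud_orthonormal theta phi :
  orthonormal_pair (ket_u theta phi) (ket_d theta phi).
Proof.
have e1 : (cos (theta / 2))%:C ^+ 2 + (sin (theta / 2))%:C ^+ 2 = 1 :> R[i].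
  by rewrite -!rmorphXn -rmorphD cos2Dsin2.
have e2 := expi_conj phi.
split; rewrite /ket_u /ket_d !bkE !braket_ket ?rmorphM /= ?conj_real;
  move: (cos _)%:C (sin _)%:C (expi phi) (_^*%R) e1 e2 => c s e f e1 e2.
- by transitivity (c ^+ 2 + s ^+ 2 * (f * e)); [ring | rewrite e2 mulr1].
- transitivity (s ^+ 2 + c ^+ 2 * (f * e)); first by ring.
  by rewrite e2 mulr1 addrC.
- by ring: e2.
- by ring: e2.
Qed.

Lemma sum_basis_orthonormal a b : orthonormal_pair a b ->
  orthonormal_basis (sum_basis a b).
Proof.
case=> aa bb ab ba; apply: pair_basis_orthonormal.
have hh := invsqrt2_sqr.
by split; rewrite !bkE conj_real aa bb ab ba mulrDr !mulrA hh; field.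
Qed.

Lemma pair_scale_i a b : orthonormal_pair a b -> orthonormal_pair a ('i%C *: b).
Proof.
have ii : ('i%C : R[i])^*%R * 'i%C = 1.
  by apply/eqP; rewrite eq_complex /=; apply/andP; split; apply/eqP; ring.
case=> aa bb ab ba.
by split; rewrite ?bkE ?aa ?bb ?ab ?ba ?mulr0// mulr1.
Qed.

Lemma B1_orthonormal theta phi : orthonormal_basis (B1 theta phi).
Proof. exact/pair_basis_orthonormal/ud_orthonormal. Qed.

Lemma B2_orthonormal theta phi : orthonormal_basis (B2 theta phi).
Proof. exact/sum_basis_orthonormal/ud_orthonormal. Qed.

Lemma B3_orthonormal theta phi : orthonormal_basis (B3 theta phi).
Proof. exact/sum_basis_orthonormal/pair_scale_i/ud_orthonormal. Qed.

Lemma ket_orthonormal : orthonormal_pair (ket 0) (ket 1).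
Proof. by split; rewrite braket_ket. Qed.

Lemma x_basis_orthonormal : orthonormal_basis (@x_basis R).
Proof. exact/sum_basis_orthonormal/ket_orthonormal. Qed.

Lemma y_basis_orthonormal : orthonormal_basis (@y_basis R).
Proof. exact/sum_basis_orthonormal/pair_scale_i/ket_orthonormal. Qed.

Lemma pair_sum_unbiased a b : orthonormal_pair a b ->
  mutually_unbiased [tuple a; b] (sum_basis a b).
Proof.
case=> aa bb ab ba; have hh := invsqrt2_sqr.
apply: ord2P; apply: ord2P; rewrite !(tnth_nth 0) /= !bkE ?aa ?bb ?ab ?ba
  ?(addr0, add0r, subr0, sub0r, mulr1, mulrN) ?normrN normCK conj_real.
all: by rewrite hh.
Qed.

Lemma sum_sum_i_unbiased a b : orthonormal_pair a b ->
  mutually_unbiased (sum_basis a b) (sum_basis a ('i%C *: b)).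
Proof.
case=> aa bb ab ba; have hh := invsqrt2_sqr.
have n1 : `|1 + 'i%C : R[i]| ^+ 2 = 2.
  rewrite normCK; apply/eqP; rewrite eq_complex /=.
  by apply/andP; split; apply/eqP; ring.
have n2 : `|1 - 'i%C : R[i]| ^+ 2 = 2.
  rewrite normCK; apply/eqP; rewrite eq_complex /=.
  by apply/andP; split; apply/eqP; ring.
have h2 : `|2^-1 : R[i]| ^+ 2 * 2 = 2^-1.
  by rewrite ger0_norm ?invr_ge0//; field.
apply: ord2P; apply: ord2P; rewrite !(tnth_nth 0) /= !bkE ?aa ?bb ?ab ?ba.
all: rewrite conj_real -mulrDr mulrA hh normrM exprMn.
all: rewrite ?(mulr0, mulr1, addr0, add0r, subr0, sub0r, oppr0, opprK).
all: by rewrite ?mulrN1 ?n1 ?n2 h2.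
Qed.

Lemma bases_unbiased theta phi :
  [/\ mutually_unbiased (B1 theta phi) (B2 theta phi),
      mutually_unbiased (B1 theta phi) (B3 theta phi) &
      mutually_unbiased (B2 theta phi) (B3 theta phi)].
Proof.
have ud := ud_orthonormal theta phi.
split; [exact: pair_sum_unbiased| |exact: sum_sum_i_unbiased].
have ub := pair_sum_unbiased (pair_scale_i ud).
have ni : `|('i%C : R[i])^*%R| = 1.
  by rewrite norm_conjC normc_def /= expr0n expr1n add0r sqrtr1.
apply: ord2P => j; first exact: (ub 0 j).
have t1 (x y : 'cV[R[i]]_2) : tnth [tuple x; y] 1 = y by [].
have := ub 1 j; rewrite /mutually_unbiased /B1 /B3.
move: (sum_basis _ _) => B; rewrite t1 braketZl normrM ni mul1r => <-.
by rewrite t1.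
Qed.

Lemma bloch_cauchy (x y z u v w : R) : x ^+ 2 + y ^+ 2 + z ^+ 2 <= 1 ->
  forall s, 0 <= s -> u ^+ 2 + v ^+ 2 + w ^+ 2 = s ^+ 2 ->
  0 <= s + (u * x + v * y + w * z).
Proof.
move=> n1 s s0 vs; rewrite -lerBlDl sub0r lerNl.
apply: le_trans (ler_norm _) _; rewrite normrN -(ler_pXn2r (_ : 0 < 2)%N)//
  ?nnegrE// real_normK ?num_real//.
have : s ^+ 2 * (x ^+ 2 + y ^+ 2 + z ^+ 2) <= s ^+ 2.
  by rewrite ler_piMr// sqr_ge0.
apply: le_trans; rewrite -vs -subr_ge0.
have -> : (u ^+ 2 + v ^+ 2 + w ^+ 2) * (x ^+ 2 + y ^+ 2 + z ^+ 2)
    - (u * x + v * y + w * z) ^+ 2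
  = (u * y - v * x) ^+ 2 + (u * z - w * x) ^+ 2 + (v * z - w * y) ^+ 2 by ring.
by rewrite !addr_ge0// sqr_ge0.
Qed.

Lemma big_ord2E (V : nmodType) (F : 'I_2 -> V) : \sum_i F i = F 0 + F 1.
Proof.
rewrite big_ord_recl big_ord1; congr (_ + F _); exact/val_inj.
Qed.

Lemma big_ord3E (V : nmodType) (F : 'I_3 -> V) :
  \sum_i F i = F 0 + F 1 + F (inord 2).
Proof.
rewrite !big_ord_recl big_ord0 addr0 addrA.
by congr (_ + F _ + F _); apply/val_inj; rewrite //= inordK.
Qed.

Lemma qubit_state_density (n : 'rV[R]_3) :
  euclidean_norm n <= 1 -> density_matrix (qubit_state n).
Proof.
rewrite /euclidean_norm -[X in _ <= X]sqrtr1 ler_psqrt ?nnegrE// ?sumr_ge0//;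
  last by move=> k _; exact: sqr_ge0.
rewrite big_ord3E.
rewrite /density_matrix /psdmx /qubit_state big_ord3E 3!(tnth_nth 0) /= inordK//=.
move: (n 0 0) (n 0 1) (n 0 (inord 2)) => x y z n1.
set rho := _ *: _.
have h : 2^-1 = (2^-1)%:C :> R[i] by rewrite fmorphV rmorph_nat.
have r00 : rho 0 0 = ((1 + z) / 2)%:C.
  rewrite !mxE /= h; apply/eqP; rewrite eq_complex /=.
  by apply/andP; split; apply/eqP; field.
have r11 : rho 1 1 = ((1 - z) / 2)%:C.
  rewrite !mxE /= h; apply/eqP; rewrite eq_complex /=.
  by apply/andP; split; apply/eqP; field.
have r01 : rho 0 1 = (x / 2) +i* (- (y / 2)).
  rewrite !mxE /= h; apply/eqP; rewrite eq_complex /=.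
  by apply/andP; split; apply/eqP; field.
have r10 : rho 1 0 = (x / 2) +i* (y / 2).
  rewrite !mxE /= h; apply/eqP; rewrite eq_complex /=.
  by apply/andP; split; apply/eqP; field.
split; last first.
  rewrite /mxtrace big_ord2E r00 r11; apply/eqP; rewrite eq_complex /=.
  by apply/andP; split; apply/eqP; field.
split=> [|c].
  apply/matrixP => i j; rewrite 2!mxE; move: i j.
  apply: ord2P; apply: ord2P; rewrite ?r00 ?r11 ?r01 ?r10;
  by apply/eqP; rewrite eq_complex /= ?opprK ?oppr0 !eqxx.
rewrite !mxE big_ord2E !mxE !big_ord2E r00 r01 r10 r11 !mxE.
move: (c 0 0) (c 1 0) => [a1 a2] [b1 b2].
have := @bloch_cauchy x y z (2 * (a1 * b1 + a2 * b2))
  (2 * (a1 * b2 - a2 * b1)) (a1 ^+ 2 + a2 ^+ 2 - b1 ^+ 2 - b2 ^+ 2) n1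
  (a1 ^+ 2 + a2 ^+ 2 + b1 ^+ 2 + b2 ^+ 2).
move=> /(_ _ _)/wrap[]; first by rewrite !addr_ge0// sqr_ge0.
  by ring.
move=> q0; rewrite lecE /=; apply/andP; split; first by apply/eqP; field.
have -> : 0 = 2^-1 * 0 :> R by rewrite mulr0.
move: q0; rewrite -(@ler_pM2l _ 2^-1) ?invr_gt0// => /le_trans; apply.
by rewrite le_eqVlt; apply/orP; left; apply/eqP; field.
Qed.

End QubitFacts.

(* Main.v *)
Require Import Defs.
From mathcomp Require Import all_boot all_order all_algebra.
From mathcomp Require Import spectral sesquilinear ring.
From mathcomp Require Import complex.
From mathcomp Require Import all_classical all_reals all_analysis.

Import Order.TTheory GRing.Theory Num.Theory.
Local Open Scope ring_scope.
Local Open Scope complex_scope.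

(** For an orthonormal pair (a, b) put z = <a|rho|b>.  The antisymmetric part of
    a 2x2 matrix V has V^* V scalar, so the robustness in a two-element basis is
    the modulus of the difference of the two off-diagonal entries.  It equals
    |z - z^*| both in {a, b} and in {(a + b)/sqrt 2, (a - b)/sqrt 2}, and
    |z + z^*| in {(a + i b)/sqrt 2, (a - i b)/sqrt 2}.  The squares add up to
    4 |z|^2, and positivity gives 2 |z| <= <a|rho|a> + <b|rho|b> = tr rho = 1. *)

Section Sesquilinear.
Local Open Scope sesquilinear_scope.
Context {C : numClosedFieldType} {n : nat}.
Implicit Types (A V : 'M[C]_n) (x y : 'cV[C]_n) (c : C).

(** Nothing is known about the unitary that [spectralmx] selects, but a scalar matrix commutes with
    it, so every entry of the spectral diagonal is forced to be [c]. *)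
Lemma sqrtmx_scalar c : sqrtmx (c%:M : 'M[C]_n) = (sqrtC c)%:M.
Proof.
have cN : (c%:M : 'M[C]_n) \is normalmx.
  by apply/normalmxP; rewrite tr_scalar_mx map_scalar_mx /= -!scalar_mxM mulrC.
have /orthomx_spectralP E := cN.
have U := spectral_unit (c%:M : 'M[C]_n).
rewrite /sqrtmx; set P := spectralmx _ in E U *; set s := spectral_diag _ in E *.
have sE i : s 0 i = c.
  have : P *m c%:M *m invmx P = diag_mx s.
    by rewrite E -!mulmxA mulmxV// mulmx1 mulmxA mulmxV// mul1mx.
  rewrite scalar_mxC mulmxK// => /matrixP/(_ i i).
  by rewrite !mxE eqxx !mulr1n.
have -> : diag_mx (map_mx sqrtC s) = (sqrtC c)%:M.
  by apply/matrixP => i j; rewrite !mxE sE.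
by rewrite scalar_mxC mulmxKV.
Qed.

Lemma trace_norm_gram_scalar V c :
  V ^t* *m V = c%:M -> trace_norm V = sqrtC c *+ n.
Proof. by rewrite /trace_norm => ->; rewrite sqrtmx_scalar mxtrace_scalar. Qed.

Lemma braket_herm A x y : A ^t* = A ->
  braket x (A *m y) = (braket y (A *m x))^*%R.
Proof.
move=> Ah; rewrite braketC; congr (_^*%R).
by rewrite /braket trmx_mul map_mxM Ah mulmxA.
Qed.

Lemma psdmx_offdiag_le A x y : psdmx A ->
  2 * `|braket x (A *m y)| <= braket x (A *m x) + braket y (A *m y).
Proof.
case=> Ah A0.
have pos v : 0 <= braket v (A *m v) by rewrite /braket mulmxA.
have zC := braket_herm _ y x Ah.
set z := braket x (A *m y) in zC *.
(* The phase chosen below divides by |z|, so z = 0 is treated apart. *)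
have [->|z0] := eqVneq z 0; first by rewrite normr0 mulr0 addr_ge0.
have n0 : `|z| != 0 by rewrite normr_eq0.
have zz := normCK z.
(* this unit phase turns the cross terms of x + c y into -2 |z| *)
have := pos (x + (- (z^*%R / `|z|)) *: y).
rewrite mulmxDr -scalemxAr !bkE -/z zC.
have -> : (- (z^*%R / `|z|))^*%R = - (z / `|z|).
  by rewrite rmorphN /= rmorphM /= conjCK fmorphV /= (CrealP (normr_real z)).
set p := braket _ _; set q := braket _ _; move: n0 zz.
move: `|z| (z^*%R) => m w m0 zz H.
rewrite -subr_ge0; apply: le_trans H _; rewrite le_eqVlt; apply/orP; left.
by apply/eqP; field: zz.
Qed.

(** With the basis vectors as the columns of P, the summands are the diagonal entries of P^* A P,
    and the trace is invariant under unitary conjugation. *)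
Lemma orthonormal_trace (B : n.-tuple 'cV[C]_n) A : orthonormal_basis B ->
  \sum_i braket (tnth B i) (A *m tnth B i) = \tr A.
Proof.
move=> oB; pose P : 'M[C]_n := \matrix_(i, j) tnth B j i 0.
have colP j : col j P = tnth B j.
  by apply/matrixP => i k; rewrite !mxE ord1.
have entry M i j : (P ^t* *m M *m P) i j = braket (tnth B i) (M *m tnth B j).
  rewrite /braket mulmxA -!colP.
  have -> : (col i P) ^t* = row i (P ^t*) by apply/matrixP => k l; rewrite !mxE.
  by rewrite -row_mul [LHS]mxE [RHS]mxE; apply: eq_bigr => k _; rewrite !mxE.
have PP : P ^t* *m P = 1%:M.
  (* An identity is inserted so that [entry], at M = 1, turns the Gram entries into brackets of
     basis vectors. *)
  by apply/matrixP => i j; rewrite -(mulmx1 (P ^t*)) entry mul1mx oB mxE.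
transitivity (\tr (P ^t* *m A *m P)).
  by apply: eq_bigr => i _; rewrite entry.
by rewrite mxtrace_mulC mulmxA (mulmx1C PP) mul1mx.
Qed.

End Sesquilinear.

Lemma robustness_imag_pair (C : numClosedFieldType) (a b : 'cV[C]_2) rho :
  robustness_imag [tuple a; b] rho
    = `|braket a (rho *m b) - braket b (rho *m a)|.
Proof.
rewrite /robustness_imag; set k := _ - braket b _.
(* The antisymmetric part has zero diagonal and off-diagonal entries k and -k; its trace norm 2 |k|
   cancels the factor 1/2. *)
rewrite (@trace_norm_gram_scalar _ _ _ (`|k| ^+ 2)).
  by rewrite sqrCK// -[`|k| *+ 2]mulr_natl mulKf// pnatr_eq0.
apply/matrixP => i j; move: i j.
by apply: ord2P; apply: ord2P; rewrite !mxE big_ord2E !mxE !(tnth_nth 0) /=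
  normCK /k ?mulr1n ?mulr0n ?rmorphB /=; ring.
Qed.

Section SumBasis.
Context {R : realType}.
Implicit Types (a b : 'cV[R[i]]_2) (rho : 'M[R[i]]_2).

(** Passing to (a + b)/sqrt 2, (a - b)/sqrt 2 only flips the sign of the difference of the
    off-diagonal entries. Hence [B1] and [B2] give the same value, and the two inequalities of the
    theorem become one. *)
Lemma robustness_imag_sum_basis a b rho :
  robustness_imag (sum_basis a b) rho = robustness_imag [tuple a; b] rho.
Proof.
rewrite /sum_basis !robustness_imag_pair -[RHS]normrN; congr `|_|.
rewrite -!scalemxAr !mulmxDr !mulmxN !bkE !conj_real.
have : (Num.sqrt 2)^-1%:C * (Num.sqrt 2)^-1%:C * 2 = 1 :> R[i].
  by rewrite invsqrt2_sqr mulVf// pnatr_eq0.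
move: (_^-1%:C) => s ss; rewrite -[RHS]mul1r -ss; ring.
Qed.

Lemma robustness_imag_pair_i a b rho :
  robustness_imag [tuple a; 'i%C *: b] rho
    = `|braket a (rho *m b) + braket b (rho *m a)|.
Proof.
rewrite robustness_imag_pair -!scalemxAr !bkE.
have -> : ('i%C : R[i])^*%R = - 'i%C.
  by apply/eqP; rewrite eq_complex /= oppr0 !eqxx.
have ni : `|'i%C : R[i]| = 1.
  by rewrite normc_def /= expr0n expr1n add0r sqrtr1.
by rewrite mulNr opprK -mulrDr normrM ni mul1r.
Qed.

Lemma robustness_imag_pair_le a b rho : orthonormal_pair a b ->
  density_matrix rho ->
  robustness_imag [tuple a; b] rho + robustness_imag [tuple a; 'i%C *: b] rho
    <= (Num.sqrt 2)%:C.
Proof.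
move=> ab [rpsd tr1].
rewrite robustness_imag_pair_i robustness_imag_pair.
rewrite (braket_herm _ b a (proj1 rpsd)).
have := psdmx_offdiag_le _ a b rpsd.
have := orthonormal_trace _ rho (pair_basis_orthonormal ab).
rewrite big_ord2E tr1 !(tnth_nth 0) /= => ->.
set z := braket _ _ => zle.
rewrite -(@ler_pXn2r _ 2)// ?nnegrE ?addr_ge0//; last first.
  by rewrite lecR sqrtr_ge0.
have -> : (Num.sqrt 2)%:C ^+ 2 = 2 :> R[i].
  by rewrite -rmorphXn /= sqr_sqrtr// rmorph_nat.
have zz2 : (2 * `|z|) ^+ 2 <= 1 by rewrite expr_le1// mulr_ge0.
(* For the two moduli p and q, (p + q)^2 <= 2 (p^2 + q^2), and the parallelogram law gives p^2 + q^2
   = 4 |z|^2. *)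
apply: le_trans (_ : 2 * (2 * `|z|) ^+ 2 <= 2); last by rewrite ler_piMr.
set p := `|_ - _|; set q := `|_ + _|.
have -> : (2 * `|z|) ^+ 2 = p ^+ 2 + q ^+ 2.
  by rewrite exprMn !normCK rmorphB rmorphD /= conjCK; ring.
rewrite -subr_ge0.
have -> : 2 * (p ^+ 2 + q ^+ 2) - (p + q) ^+ 2 = (p - q) ^+ 2 by ring.
by rewrite real_exprn_even_ge0// rpredB// normr_real.
Qed.

End SumBasis.

Theorem mainTheorem7 (R : realType) :
  (forall n : 'rV[R]_3, euclidean_norm n <= 1 ->
     (forall theta phi : R, 0 <= theta <= pi -> 0 <= phi <= 2 * pi ->
        robustness_imag (B2 theta phi) (qubit_state n)
          + robustness_imag (B3 theta phi) (qubit_state n)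
          <= (Num.sqrt 2)%:C
        /\
        robustness_imag (B1 theta phi) (qubit_state n)
          + robustness_imag (B3 theta phi) (qubit_state n)
          <= (Num.sqrt 2)%:C)
     /\
     robustness_imag x_basis (qubit_state n)
       + robustness_imag y_basis (qubit_state n)
       <= (Num.sqrt 2)%:C)
  /\
  (let rho : 'M[R[i]]_2 :=
     2^-1 *: (1%:M + (Num.sqrt 2)^-1%:C *: (sigma_x + sigma_y)) in
   robustness_imag x_basis rho + robustness_imag y_basis rho
     = (Num.sqrt 2)%:C).
Proof.
split=> [n /qubit_state_density dn|rho].
  split=> [theta phi _ _|].
    rewrite /B2 /B3 !robustness_imag_sum_basis.
    by split; exact: robustness_imag_pair_le (ud_orthonormal theta phi) dn.
  rewrite /x_basis /y_basis !robustness_imag_sum_basis.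
  exact: robustness_imag_pair_le (ket_orthonormal R) dn.
rewrite /x_basis /y_basis !robustness_imag_sum_basis.
rewrite robustness_imag_pair_i robustness_imag_pair.
have entry (k l : 'I_2) : braket (ket k) (rho *m ket l) = rho k l.
  by rewrite /braket /ket trmx_delta map_delta_mx -colE -rowE !mxE.
rewrite !entry.
have s2 : Num.sqrt 2 != 0 :> R by rewrite sqrtr_eq0 -ltNge.
have ss : (Num.sqrt 2) ^+ 2 = 2 :> R by rewrite sqr_sqrtr.
have h : 2^-1 = (2^-1)%:C :> R[i] by rewrite fmorphV rmorph_nat.
(* The off-diagonal entries are (1 - i)/(2 sqrt 2) and (1 + i)/(2 sqrt 2); their difference and
   their sum both have modulus 1/sqrt 2. *)
have -> : rho 0 1 - rho 1 0 = - 'i%C * ((Num.sqrt 2)^-1)%:C.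
  rewrite !mxE /= h; apply/eqP; rewrite eq_complex /=.
  by apply/andP; split; apply/eqP; field.
have -> : rho 0 1 + rho 1 0 = ((Num.sqrt 2)^-1)%:C.
  rewrite !mxE /= h; apply/eqP; rewrite eq_complex /=.
  by apply/andP; split; apply/eqP; field.
have ni : `|'i%C : R[i]| = 1.
  by rewrite normc_def /= expr0n expr1n add0r sqrtr1.
rewrite normrM normrN ni mul1r ger0_norm ?lecR ?invr_ge0 ?sqrtr_ge0//.
rewrite -rmorphD /=; congr (_%:C).
by field: ss.
Qed.
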